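(* Let $D$ be an integral domain. Then $D$ is an integrally closed $w$-divisorial domain if and only if $D[X]$ is an integrally closed $w$-divisorial domain.
   Context: For a domain $D$ with quotient field $K$ and fractional ideals $I,J$: $(I:J)=\{x\in K\mid xJ\subseteq I\}$. For a nonzero fractional ideal $I$: $I^{-1}=(D:I)$, $I_v=(I^{-1})^{-1}$, and $I_w=\bigcup (I:J)$, the union being over all finitely generated ideals $J$ of $D$ with $J_v=D$. A nonzero ideal $I$ is divisorial if $I=I_v$ and a $w$-ideal if $I=I_w$. A domain is $w$-divisorial if each of its $w$-ideals is divisorial. $D[X]$ is the polynomial ring in one indeterminate. *)

(* Defs.v *)
From mathcomp Require Import all_boot all_order all_algebra.
From mathcomp Require Import classical_sets.

Set Implicit Arguments.
Unset Strict Implicit.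
Unset Printing Implicit Defensive.

Import GRing.Theory.

Local Open Scope classical_set_scope.
Local Open Scope ring_scope.

Notation tofrac := FracField.tofrac.

Section Ideals.
Variable D : idomainType.
Local Notation K := {fraction D}.
Implicit Types I J : set K.

Definition base_ring : set K := range (@tofrac D).

Definition integrally_closed : Prop :=
  forall x : K, integralOver (@tofrac D) x -> base_ring x.

Definition fractional_ideal I : Prop :=
  [/\ I 0,
      (forall x y, I x -> I y -> I (x + y)),
      (forall (d : D) x, I x -> I (tofrac d * x)) &
      exists2 d : D, d != 0 & forall x, I x -> base_ring (tofrac d * x)].

(* Ideals of D are represented by their images in K. *)
Definition ideal_of I : Prop := fractional_ideal I /\ I `<=` base_ring.

Definition nonzero_ideal I : Prop := ideal_of I /\ I <> [set 0].

Definition span n (a : 'I_n -> K) : set K :=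
  [set x | exists c : 'I_n -> D, x = \sum_(i < n) tofrac (c i) * a i].

Definition finitely_generated J : Prop :=
  exists n (a : 'I_n -> K), J = span a.

Definition colon I J : set K := [set x | forall y, J y -> I (x * y)].

Definition ideal_inv I : set K := colon base_ring I.

Definition v_closure I : set K := ideal_inv (ideal_inv I).

(* J ranges over nonzero ideals, since J_v is only defined for those; this
   matters when D is a field, where formally the zero ideal would qualify. *)
Definition w_closure I : set K :=
  \bigcup_(J in [set J | [/\ nonzero_ideal J, finitely_generated J
                           & v_closure J = base_ring]]) colon I J.

Definition divisorial I : Prop := nonzero_ideal I /\ I = v_closure I.

Definition w_ideal I : Prop := nonzero_ideal I /\ I = w_closure I.

Definition w_divisorial : Prop := forall I, w_ideal I -> divisorial I.

End Ideals.

(* Main.v *)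
(* Call a finite list "gv" when it generates a nonzero ideal J with J_v = D.  A
   domain is w-divisorial iff I_v is contained in I_w for every nonzero ideal I,
   because I_w is a w-ideal.

   The main tool is the Dedekind-Mertens lemma: if D is integrally
   closed and f, g in K[X] have product in D[X], then all products of a
   coefficient of f and a coefficient of g lie in D, since they stabilize a
   nonzero finitely generated D-module.

   From D to D[X]: divisoriality and integral closedness of D make every finite
   nonzero list w-invertible.  Let W be a w-ideal of D[X] and f in W of minimal
   degree, so that W lies in f K[X].  If f u is in W, then u_k f is in W for every
   coefficient u_k of u: with b_1, ..., b_r a w-inverse of the coefficients of u
   and d a common denominator of them, the list d, b_1 u, ..., b_r u is gv in D[X]
   and multiplies u_k f into W.  Hence W = f I[X] with I a fractional w-ideal of
   D, and W_v = f I_v[X] = W.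

   From D[X] to D: if x is in I_v, then x is in (I D[X])_v, hence in (I D[X])_w,
   and the coefficients of the polynomials witnessing the latter are a gv list
   of D witnessing that x is in I_w. *)
Require Import Defs.
From HB Require Import structures.
From mathcomp Require Import all_boot all_order all_algebra.
From mathcomp Require Import boolp classical_sets.

Set Implicit Arguments.
Unset Strict Implicit.
Unset Printing Implicit Defensive.

Import GRing.Theory.

Local Open Scope classical_set_scope.
Local Open Scope ring_scope.

(** * Fractions, common denominators and integral elements of [K] *)

Section FractionField.
Variable D : idomainType.
Local Notation K := {fraction D}.
Local Notation base := (@base_ring D).

Lemma base_ring_tofrac (a : D) : base (tofrac a).
Proof. by exists a. Qed.

Lemma base_ring0 : base 0.
Proof. by exists 0; rewrite ?tofrac0. Qed.

Lemma base_ringD x y : base x -> base y -> base (x + y).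
Proof. by move=> [a _ <-] [b _ <-]; exists (a + b); rewrite ?tofracD. Qed.

Lemma base_ringB x y : base x -> base y -> base (x - y).
Proof. by move=> [a _ <-] [b _ <-]; exists (a - b); rewrite ?tofracB. Qed.

Lemma base_ringM x y : base x -> base y -> base (x * y).
Proof. by move=> [a _ <-] [b _ <-]; exists (a * b); rewrite ?tofracM. Qed.

Lemma base_ring_sum (I : Type) (r : seq I) (P : pred I) (F : I -> K) :
  (forall i, P i -> base (F i)) -> base (\sum_(i <- r | P i) F i).
Proof.
by move=> bF; apply: big_ind => //; [exact: base_ring0 | exact: base_ringD].
Qed.

Lemma fraction_divP (x : K) :
  exists2 ab : D * D, ab.2 != 0 & x = tofrac ab.1 / tofrac ab.2.
Proof.
elim/generic_quotient.quotW: x => r.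
have r2 : (r : D * D).2 != 0 by exact: denom_ratioP.
exists (r : D * D) => //.
apply: (mulIf (x := tofrac (r : D * D).2)); rewrite ?tofrac_eq0 //.
rewrite divfK ?tofrac_eq0 //; apply/eqP; unlock FracField.tofrac.
rewrite -[X in X == _]FracField.pi_mul.
apply/eqP/generic_quotient.eqmodP => /=.
by rewrite FracField.equivfE /FracField.mulf !numden_Ratio;
  rewrite ?mulf_neq0 ?oner_neq0 // !mulr1 mulrC.
Qed.

Lemma common_denominator (s : seq K) :
  exists2 d : D, d != 0 & forall x, x \in s -> base (tofrac d * x).
Proof.
elim: s => [|x s [d d0 ds]]; first by exists 1; rewrite ?oner_neq0.
have [[a b] /= b0 ->] := fraction_divP x.
have b0' : tofrac b != 0 :> K by rewrite tofrac_eq0.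
exists (d * b) => [|y]; first by rewrite mulf_neq0.
rewrite inE tofracM => /orP[/eqP -> | ys].
  by exists (d * a) => //; rewrite -mulrA [tofrac b * _]mulrC divfK ?tofracM.
by rewrite mulrAC; apply: base_ringM (ds _ ys) (base_ring_tofrac _).
Qed.

(** Determinant trick: the row of the [a i] is an eigenvector, with eigenvalue [x], of a matrix over
    [D], so [x] is a root of its monic characteristic polynomial. *)
Lemma integral_of_stable_span n (a : 'I_n -> K) (x : K) (i0 : 'I_n) :
  a i0 != 0 -> (forall i, Defs.span a (x * a i)) -> integralOver (@tofrac D) x.
Proof.
move=> a0 stab.
have /choice[c cP] : forall i, exists c : 'I_n -> D,
    x * a i = \sum_(j < n) tofrac (c j) * a j.
  by move=> i; exact: stab.
pose A := \matrix_(j, i) c i j.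
exists (char_poly A); first exact: char_poly_monic.
rewrite map_char_poly -eigenvalue_root_char; apply/eigenvalueP.
exists (\row_i a i); last first.
  by apply/eqP => /rowP /(_ i0); rewrite !mxE => /eqP; rewrite (negPf a0).
by apply/rowP => i; rewrite !mxE cP; apply: eq_bigr => j _; rewrite !mxE mulrC.
Qed.

End FractionField.

(** * The Dedekind-Mertens lemma *)

(* Northcott's induction: strip the leading terms, once from f and once from g.
   The subgroup S stands for c(f g) c(g)^(m - 1), and the claim for
   c(f) c(g)^m being contained in it. *)
Lemma dedekind_mertens (R : comNzRingType) m n (f g : {poly R}) (S : R -> Prop) :
  S 0 -> (forall x y, S x -> S y -> S (x - y)) ->
  (size f <= m)%N -> (size g <= n)%N ->
  (forall l t, size t = m.-1 -> S ((f * g)`_l * \prod_(j <- t) g`_j)) ->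
  forall i s, size s = m -> S (f`_i * \prod_(j <- s) g`_j).
Proof.
elim: m n f g S => [|m IHm] n f g S S0 SB.
  rewrite leqn0 size_poly_eq0 => /eqP -> _ _ i s _.
  by rewrite coef0 mul0r.
elim: n f g => [|n IHn] f g sf sg Sfg i s ss.
  move: sg ss; rewrite leqn0 size_poly_eq0 => /eqP ->.
  by case: s => // j s _; rewrite big_cons coef0 mul0r mulr0.
pose a := f`_m; pose b := g`_n.
pose f1 := f - a *: 'X^m; pose g1 := g - b *: 'X^n.
have cX (p : {poly R}) c k l :
    (p * (c *: 'X^k))`_l = if (l < k)%N then 0 else c * p`_(l - k).
  by rewrite -scalerAr coefZ coefMXn; case: ifP; rewrite ?mulr0.
have f1E l : f1`_l = if l == m then 0 else f`_l.
  rewrite coefB coefZ coefXn; case: eqP => [->|_].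
    by rewrite mulr1 subrr.
  by rewrite mulr0 subr0.
have g1E l : g1`_l = if l == n then 0 else g`_l.
  rewrite coefB coefZ coefXn; case: eqP => [->|_].
    by rewrite mulr1 subrr.
  by rewrite mulr0 subr0.
have sf1 : (size f1 <= m)%N.
  apply/leq_sizeP => l ml; rewrite f1E; case: eqP => // /eqP lm.
  by apply: (leq_sizeP _ _ sf); rewrite ltn_neqAle eq_sym lm.
have sg1 : (size g1 <= n)%N.
  apply/leq_sizeP => l ml; rewrite g1E; case: eqP => // /eqP lm.
  by apply: (leq_sizeP _ _ sg); rewrite ltn_neqAle eq_sym lm.
have fgmn : (f * g)`_(m + n) = a * b.
  have -> : f * g = f1 * g + g * (a *: 'X^m) by rewrite [g * _]mulrC -mulrDl subrK.
  rewrite coefD cX ltnNge leq_addr /= addKn nth_default ?add0r //.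
  apply: leq_trans (size_polyMleq _ _) _.
  by rewrite -subn1 leq_subLR add1n -addnS leq_add.
have cons_prod j t : g`_j * \prod_(k <- t) g`_k = \prod_(k <- j :: t) g`_k.
  by rewrite big_cons.
have Sab t : size t = m -> S (a * (b * \prod_(j <- t) g`_j)).
  by move=> st; rewrite mulrA -fgmn; apply: Sfg.
(* The induction on [m] applies to [f1] and the subgroup of those [x] with [b * x] in [S]; its
   hypothesis comes from [f1 * g = f * g - a X^m g]. *)
have Sf1 k t : size t = m -> S (b * (f1`_k * \prod_(j <- t) g`_j)).
  move=> st; apply: (IHm n.+1 f1 g (fun x => S (b * x))) st => //.
  - by rewrite mulr0.
  - by move=> x y Sx Sy; rewrite mulrBr; apply: SB.
  (* For [m = 0] truncation keeps [m.-1] at 0, leaving no room for the extra factor [b]; but then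
     [f1] is zero. *)
  case: m {IHm} => [|m] in a f1 sf f1E sf1 fgmn Sab Sfg {s ss IHn} *.
    move=> l t' _; move: sf1; rewrite leqn0 size_poly_eq0 => /eqP ->.
    by rewrite mul0r coef0 mul0r mulr0.
  move=> l t' /= st'.
  have -> : f1 * g = f * g - g * (a *: 'X^(m.+1)) by rewrite [g * _]mulrC -mulrBl.
  rewrite coefB cX mulrBl mulrBr; apply: SB.
    by rewrite mulrCA cons_prod; apply: Sfg; rewrite /= st'.
  case: ifP => _; first by rewrite mul0r mulr0.
  by rewrite -mulrA mulrCA cons_prod; apply: Sab; rewrite /= st'.
have Sf k t : size t = m -> S (b * (f`_k * \prod_(j <- t) g`_j)).
  move=> st; have := Sf1 k t st; rewrite f1E; case: eqP => // -> _.
  by rewrite mulrCA; apply: Sab.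
(* A product with the factor [b = g_n] is settled by [Sf]. Any other is unchanged when [g] becomes
   [g1], and the induction on [n] applies. *)
have [ns|nNs] := boolP (n \in s).
  rewrite (big_rem _ ns) /= mulrCA; apply: Sf.
  by rewrite size_rem // ss.
have g1s t : n \notin t -> \prod_(j <- t) g1`_j = \prod_(j <- t) g`_j.
  move=> nt; rewrite big_seq [RHS]big_seq; apply: eq_bigr => j jt.
  by rewrite g1E; case: eqP => // jn; rewrite -jn jt in nt.
rewrite -g1s //; apply: IHn => //= l t st.
have [nt|nNt] := boolP (n \in t).
  by rewrite (big_rem _ nt) /= g1E eqxx mul0r mulr0.
rewrite g1s // mulrBr coefB cX mulrBl; apply: SB; first exact: Sfg.
case: ifP => _; first by rewrite mul0r.
by rewrite -mulrA; apply: Sf.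
Qed.

(** For [f] of degree [m], the products of [m] coefficients of [g] span a finitely generated module,
    and Dedekind-Mertens shows that each [f_i g_j] maps it into itself because [f * g] is in
    D[X]. *)
Lemma integrally_closed_coef_mul (D : idomainType) (f g : {poly {fraction D}}) :
  integrally_closed D -> (forall k, base_ring (f * g)`_k) ->
  forall i j, base_ring (f`_i * g`_j).
Proof.
move=> Dint fgD i j.
have [->|g0] := eqVneq g 0; first by rewrite coef0 mulr0; exact: base_ring0.
pose m := (size f).-1; pose T := m.-tuple 'I_(size g).
pose v (k : 'I_#|{: T}|) := \prod_(l <- (enum_val k : T)) g`_l.
(* Indices beyond the size of [g] occur in Dedekind-Mertens but not in the tuples; their products
   vanish. *)
have spanv t : size t = m -> Defs.span v (\prod_(l <- t) g`_l).
  move=> st; case: (boolP (all (fun l => l < size g)%N t)) => [/allP tg|].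
    have sg : (0 < size g)%N by rewrite size_poly_gt0.
    have st' : size (map (fun l => insubd (Ordinal sg) l) t) == m.
      by rewrite size_map st.
    pose t' : T := Tuple st'.
    exists (fun k => (k == enum_rank t')%:R).
    rewrite (bigD1 (enum_rank t')) //= eqxx tofrac1 mul1r [X in _ + X]big1 ?addr0.
      rewrite /v enum_rankK /= big_map big_seq [RHS]big_seq; apply: eq_bigr => l lt.
      by rewrite val_insubd tg.
    by move=> k /negPf ->; rewrite tofrac0 mul0r.
  case/allPn => l lt; rewrite -leqNgt => gl; exists (fun=> 0).
  rewrite [RHS]big1 => [|k _]; last by rewrite tofrac0 mul0r.
  by rewrite (big_rem _ lt) /= nth_default // mul0r.
have [->|f0] := eqVneq f 0; first by rewrite coef0 mul0r; exact: base_ring0.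
have fE : size f = m.+1 by rewrite prednK // size_poly_gt0.
apply: Dint.
have lg : ((size g).-1 < size g)%N by rewrite prednK ?size_poly_gt0.
pose t0 : T := [tuple Ordinal lg | _ < m].
apply: (@integral_of_stable_span _ _ v _ (enum_rank t0)) => [|k].
  rewrite /v enum_rankK prodf_seq_neq0; apply/allP => l /mapP[_ _ ->] /=.
  by rewrite -lead_coefE lead_coef_eq0.
have := @dedekind_mertens _ _ _ f g (Defs.span v) _ _ (leqnn _) (leqnn _) _ i
  (j :: map val (enum_val k : T)).
rewrite big_cons big_map mulrA; apply.
- by exists (fun=> 0); rewrite big1 // => l _; rewrite tofrac0 mul0r.
- move=> _ _ [c ->] [d ->]; exists (fun l => c l - d l).
  by rewrite -sumrB; apply: eq_bigr => l _; rewrite tofracB mulrBl.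
- move=> l t /spanv[c ->]; have [d _ <-] := fgD l.
  exists (fun k => d * c k); rewrite mulr_sumr.
  by apply: eq_bigr => k' _; rewrite tofracM mulrA.
by rewrite /= size_map size_tuple fE.
Qed.

(** * The v- and w-closures through finite lists *)

Section StarOperations.
Variable D : idomainType.
Local Notation K := {fraction D}.
Local Notation base := (@base_ring D).
Implicit Types (s t : seq K) (I J : set K) (x y : K).

(* A finite list generates a nonzero finitely generated ideal J of D with
   J^-1 = D, equivalently with J_v = D. *)
Definition gv s : Prop :=
  [/\ forall y, y \in s -> base y, exists2 y, y \in s & y != 0
    & forall x, (forall y, y \in s -> base (x * y)) -> base x].

Definition submodule I : Prop :=
  [/\ I 0, forall x y, I x -> I y -> I (x + y)
    & forall x y, base x -> I y -> I (x * y)].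

Lemma submodule_sum I (T : Type) (r : seq T) (P : pred T) (F : T -> K) :
  submodule I -> (forall i, P i -> I (F i)) -> I (\sum_(i <- r | P i) F i).
Proof. by move=> [I0 ID _] IF; apply: big_ind. Qed.

Lemma fractional_ideal_submodule I : fractional_ideal I -> submodule I.
Proof. by move=> [I0 ID IM _]; split=> // _ y [a _ <-]; apply: IM. Qed.

Lemma nonzero_idealP I :
  nonzero_ideal I <->
  [/\ submodule I, forall x, I x -> base x & exists2 x, I x & x != 0].
Proof.
split=> [[[fI IbD] I0]|[mI IbD [x Ix x0]]].
  split=> //; first exact: fractional_ideal_submodule.
  apply: contrapT => nI; apply: I0; apply/seteqP; split=> [x Ix|_ ->].
    by apply: contrapT => /eqP x0; apply: nI; exists x.
  by case: fI.
split; last by move=> I0; move: Ix x0; rewrite I0 => ->; rewrite eqxx.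
split=> //; case: mI => I0 ID IM; split=> //.
  by move=> d y; apply: IM; exists d.
by exists 1; rewrite ?oner_neq0 // => y /IbD; rewrite tofrac1 mul1r.
Qed.

Lemma submodule_span n (a : 'I_n -> K) : submodule (Defs.span a).
Proof.
split=> [|_ _ [c ->] [d ->]|_ _ [b _ <-] [c ->]].
- by exists (fun=> 0); rewrite big1 // => i _; rewrite tofrac0 mul0r.
- exists (fun i => c i + d i); rewrite -big_split /=.
  by apply: eq_bigr => i _; rewrite tofracD mulrDl.
- exists (fun i => b * c i); rewrite mulr_sumr.
  by apply: eq_bigr => i _; rewrite tofracM mulrA.
Qed.

Lemma span_gen n (a : 'I_n -> K) i : Defs.span a (a i).
Proof.
exists (fun j => (j == i)%:R); rewrite (bigD1 i) //= eqxx tofrac1 mul1r.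
by rewrite [X in _ + X]big1 ?addr0 // => j /negPf ->; rewrite tofrac0 mul0r.
Qed.

(** Generators replace [J] itself: since [J] lies in D, [J_v = D] says that J^{-1} is contained in
    D, which can be tested on generators. *)
Lemma w_closureP I x :
  submodule I ->
  w_closure I x <-> exists2 s, gv s & forall y, y \in s -> I (x * y).
Proof.
move=> mI; split.
  move=> [J [/nonzero_idealP[_ JD [z Jz z0]] [n [a Ja]] Jv] xJ].
  have aJ i : J (a i) by rewrite Ja; exact: span_gen.
  exists (codom a) => [|_ /codomP[i ->]]; last exact: xJ.
  split=> [_ /codomP[i ->]||y ya]; first exact: JD.
    apply: contrapT => a0; move: z0; rewrite Ja in Jz; case: Jz => c ->.
    rewrite big1 ?eqxx // => i _; apply: contrapT => /eqP.
    rewrite mulf_eq0 negb_or => /andP[_ ai0].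
    by apply: a0; exists (a i) => //; exact: codom_f.
  have : v_closure J 1 by rewrite Jv; exists 1; rewrite ?tofrac1.
  move=> /(_ y); rewrite mul1r; apply => w; rewrite Ja => -[c ->].
  rewrite mulr_sumr; apply: base_ring_sum => i _.
  by rewrite mulrCA; apply: base_ringM (base_ring_tofrac _) (ya _ (codom_f _ _)).
move=> [s [sD [z zs z0] sinv] xs].
pose a (i : 'I_(size s)) := s`_i.
have sa y : y \in s -> Defs.span a y.
  move=> ys; have lys : (index y s < size s)%N by rewrite index_mem.
  by have := span_gen a (Ordinal lys); rewrite /a /= nth_index.
have aD y : Defs.span a y -> base y.
  move=> [c ->]; apply: base_ring_sum => i _.
  by apply: base_ringM (base_ring_tofrac _) (sD _ _); exact: mem_nth.
exists (Defs.span a); last first.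
  move=> _ [c ->]; rewrite mulr_sumr; apply: submodule_sum => // i _.
  case: mI => _ _ IM; rewrite mulrCA; apply: IM (base_ring_tofrac _) (xs _ _).
  exact: mem_nth.
split; last 2 first.
- by exists (size s), a.
- apply/seteqP; split=> [y|y by_ w winv].
    have D1 w : ideal_inv (Defs.span a) w -> base w.
      by move=> winv; apply: sinv => u /sa; exact: winv.
    by move=> yv; rewrite -[y]mulr1; apply: yv => w /aD; rewrite mul1r.
  apply: base_ringM by_ _; apply: sinv => u /sa; exact: winv.
apply/nonzero_idealP; split=> //; first exact: submodule_span.
by exists z => //; exact: sa.
Qed.

Lemma gv1 : gv [:: 1].
Proof.
split=> [y||x]; first by rewrite inE => /eqP ->; exists 1; rewrite ?tofrac1.
  by exists 1; rewrite ?inE ?oner_neq0.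
by move=> /(_ 1); rewrite inE eqxx mulr1; exact.
Qed.

(** If [x] times all products lies in D, cancelling [t] puts each [x * y] with [y] in [s] into D,
    and cancelling [s] then puts [x] there. *)
Lemma gv_mul s t : gv s -> gv t -> gv [seq x * y | x <- s, y <- t].
Proof.
move=> [sD [a sa a0] sI] [tD [b tb b0] tI]; split.
- move=> _ /allpairsP[[x y] [/= xs yt ->]].
  by apply: base_ringM; [exact: sD | exact: tD].
- by exists (a * b); [exact: allpairs_f | exact: mulf_neq0].
- move=> x xst; apply: sI => y ys; apply: tI => z zt.
  by rewrite -mulrA; apply: xst; exact: allpairs_f.
Qed.

(** The product of the individual gv lists serves all elements at once. Additivity and idempotence
    of the w-closure rest on this, as does the w-inverse below. *)
Lemma w_closure_common I s :
  submodule I -> (forall x, x \in s -> w_closure I x) ->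
  exists2 t, gv t & forall x y, x \in s -> y \in t -> I (x * y).
Proof.
move=> mI; have [_ _ IM] := mI.
elim: s => [_|x s IHs sI]; first by exists [:: 1] => //; exact: gv1.
have [y ys|t tgv st] := IHs; first by apply: sI; rewrite inE ys orbT.
have /(w_closureP _ mI)[u ugv xu] := sI x (mem_head _ _).
exists [seq y * z | y <- t, z <- u]; first exact: gv_mul.
have [tD _ _] := tgv; have [uD _ _] := ugv.
move=> y _ + /allpairsP[[a b] [/= at_ bu ->]].
rewrite inE => /orP[/eqP ->|ys].
  by rewrite mulrCA; apply: IM; [exact: tD | exact: xu].
by rewrite mulrA mulrC; apply: IM; [exact: uD | exact: st].
Qed.

Lemma sub_w_closure I : submodule I -> I `<=` w_closure I.
Proof.
move=> mI x Ix; apply/w_closureP => //; exists [:: 1]; first exact: gv1.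
by move=> y; rewrite inE => /eqP ->; rewrite mulr1.
Qed.

Lemma sub_v_closure I : I `<=` v_closure I.
Proof. by move=> x Ix y yI; rewrite mulrC; exact: yI. Qed.

Lemma v_closureS I J : I `<=` J -> v_closure I `<=` v_closure J.
Proof. by move=> IJ x xI y yJ; apply: xI => z /IJ; exact: yJ. Qed.

Lemma w_closure_ideal I : nonzero_ideal I -> nonzero_ideal (w_closure I).
Proof.
move=> /nonzero_idealP[mI ID [a Ia a0]]; have [I0 IA IM] := mI.
apply/nonzero_idealP; split; last by exists a => //; exact: sub_w_closure.
- split=> [|x y xI yI|x y xD /(w_closureP _ mI)[s sgv ys]].
  + exact: sub_w_closure.
  + have [z|t tgv xyt] := @w_closure_common I [:: x; y] mI.
      by rewrite !inE => /orP[] /eqP ->.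
    apply/w_closureP => //; exists t => // z zt; rewrite mulrDl.
    by apply: IA; apply: xyt => //; rewrite !inE eqxx ?orbT.
  + apply/w_closureP => //; exists s => // z zs; rewrite -mulrA.
    by apply: IM => //; exact: ys.
- move=> x /(w_closureP _ mI)[s [_ _ sI] xs].
  by apply: sI => y /xs /ID.
Qed.

Lemma w_closure_idem I : nonzero_ideal I -> w_closure (w_closure I) = w_closure I.
Proof.
move=> zI; have [mI _ _] := (nonzero_idealP _).1 zI.
have [mW _ _] := (nonzero_idealP _).1 (w_closure_ideal zI).
apply/seteqP; split; last exact: sub_w_closure.
move=> x /(w_closureP _ mW)[s sgv xs].
have [y|t tgv xst] := @w_closure_common I [seq x * y | y <- s] mI.
  by move=> /mapP[z zs ->]; exact: xs.
apply/w_closureP => //; exists [seq y * z | y <- s, z <- t]; first exact: gv_mul.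
move=> _ /allpairsP[[a b] [/= as_ bt ->]]; rewrite mulrA.
by apply: xst => //; exact: map_f.
Qed.

Lemma w_divisorialP :
  w_divisorial D <-> forall I, nonzero_ideal I -> v_closure I `<=` w_closure I.
Proof.
split=> [Dw I zI|Dw I [zI Iw]].
  have [mI _ _] := (nonzero_idealP _).1 zI.
  have [_ ->] : divisorial (w_closure I).
    by apply: Dw; split; [exact: w_closure_ideal | rewrite w_closure_idem].
  by apply: v_closureS; exact: sub_w_closure.
split=> //; apply/seteqP; split; first exact: sub_v_closure.
by rewrite [X in _ `<=` X]Iw; exact: Dw.
Qed.

End StarOperations.

(** The list [bs] is a w-inverse of [s]. The ideal S S^{-1} has v-closure D, so by w-divisoriality
    it contains a gv list, and finitely many elements of S^{-1} suffice to write that list. *)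
Lemma finite_w_inverse (D : idomainType) (s : seq {fraction D}) :
  integrally_closed D -> w_divisorial D -> (exists2 a, a \in s & a != 0) ->
  exists2 bs : seq {fraction D},
    forall b a, b \in bs -> a \in s -> base_ring (b * a) &
    forall x, (forall b a, b \in bs -> a \in s -> base_ring (x * (b * a))) ->
      base_ring x.
Proof.
move=> Dint /w_divisorialP Dw.
wlog sD : s / forall a, a \in s -> base_ring a.
  move=> IH [a sa a0]; have [d d0 ds] := common_denominator s.
  have d0' : tofrac d != 0 :> {fraction D} by rewrite tofrac_eq0.
  have [_ /mapP[y ys ->]||bs bsD bsI] := IH [seq tofrac d * y | y <- s].
  - exact: ds.
  - by exists (tofrac d * a); [exact: map_f | exact: mulf_neq0].
  - exists [seq b * tofrac d | b <- bs] => [_ y /mapP[b bbs ->] ys|x xbs].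
      by rewrite -mulrA; apply: bsD => //; exact: map_f.
    apply: bsI => b _ bbs /mapP[y ys ->]; rewrite mulrA.
    by rewrite mulrA -[x * b * _]mulrA -mulrA; apply: xbs => //; exact: map_f.
move=> [a0 sa0 a0N0].
pose a (i : 'I_(size s)) := s`_i.
have as_ i : a i \in s by exact: mem_nth.
have sP y : y \in s -> exists i, y = a i.
  move=> ys; have lys : (index y s < size s)%N by rewrite index_mem.
  by exists (Ordinal lys); rewrite /a /= nth_index.
pose S := Defs.span a.
have SD x : S x -> base_ring x.
  move=> [c ->]; apply: base_ring_sum => i _.
  by apply: base_ringM (base_ring_tofrac _) (sD _ _).
have mS : submodule S by exact: submodule_span.
have Sid : nonzero_ideal S.
  apply/nonzero_idealP; split=> //; exists a0 => //.
  by have [i ->] := sP _ sa0; exact: span_gen.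
have SinvP b : ideal_inv S b <-> forall i, base_ring (b * a i).
  split=> [bS i|ba _ [c ->]]; first by apply: bS; exact: span_gen.
  rewrite mulr_sumr; apply: base_ring_sum => i _; rewrite mulrCA.
  exact: base_ringM (base_ring_tofrac _) (ba _).
(* Coefficients in S^{-1} can be collected at each generator, so one [b i] per [a i] describes the
   whole product ideal. *)
pose Q : set {fraction D} := [set c | exists2 b : 'I_(size s) -> {fraction D},
  forall i, ideal_inv S (b i) & c = \sum_i b i * a i].
have Sinv0 : ideal_inv S 0.
  by apply/SinvP => i; rewrite mul0r; exact: base_ring0.
have Qgen b i : ideal_inv S b -> Q (b * a i).
  move=> bS; exists (fun j => if j == i then b else 0) => [j|].
    by case: ifP.
  rewrite (bigD1 i) //= eqxx [X in _ + X]big1 ?addr0 // => j /negPf ->.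
  by rewrite mul0r.
have Qid : nonzero_ideal Q.
  apply/nonzero_idealP; split.
  - split.
    + by exists (fun=> 0) => //; rewrite big1 // => i _; rewrite mul0r.
    + move=> _ _ [b bS ->] [c cS ->]; exists (fun i => b i + c i).
        move=> i; apply/SinvP => j; rewrite mulrDl.
        by apply: base_ringD; move: j; apply/SinvP.
      by rewrite -big_split /=; apply: eq_bigr => i _; rewrite mulrDl.
    + move=> x _ xD [c cS ->]; exists (fun i => x * c i).
        move=> i; apply/SinvP => j; rewrite -mulrA.
        by apply: base_ringM xD _; move: j; apply/SinvP.
      by rewrite mulr_sumr; apply: eq_bigr => i _; rewrite mulrA.
  - move=> _ [b bS ->]; apply: base_ring_sum => i _.
    by move: (bS i) => /SinvP.
  - exists a0 => //; have [i ->] := sP _ sa0; rewrite -[a i]mul1r.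
    by apply: Qgen; apply/SinvP => j; rewrite mul1r; exact: sD.
(* Here Q = S S^-1, and Q^-1 = (S^-1 : S^-1) = (S_v : S_v) = (S_w : S_w) = D. *)
have Qv1 : v_closure Q 1.
  move=> y yQ; rewrite mul1r.
  have [x|t [tD tn0 tI] ytS] := @w_closure_common _ S [seq y * z | z <- s] mS.
    move=> /mapP[z /sP[i ->] ->]; apply: Dw => // b bS.
    by rewrite -mulrA [a i * b]mulrC; apply: yQ; exact: Qgen.
  (* For [c] in the gv list [t], [y * c] maps [S] into itself, so it is integral and lies in D. *)
  apply: tI => c ct; apply: Dint.
  have [i0 ai0] := sP _ sa0.
  apply: (@integral_of_stable_span _ _ a _ i0) => [|i]; first by rewrite -ai0.
  by rewrite mulrAC; apply: ytS => //; exact: map_f.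
have [mQ _ _] := (nonzero_idealP _).1 Qid.
have /(w_closureP _ mQ)[t [_ _ tI] tQ] := Dw _ Qid _ Qv1.
suff [bs bsD bst] : exists2 bs : seq {fraction D},
    forall b a, b \in bs -> a \in s -> base_ring (b * a) &
    forall x, (forall b a, b \in bs -> a \in s -> base_ring (x * (b * a))) ->
      forall c, c \in t -> base_ring (x * c).
  by exists bs => // x xbs; apply: tI; exact: bst.
elim: t tQ {tI} => [_|c t IHt tQ]; first by exists [::].
have [y yt|bs bsD bst] := IHt; first by apply: tQ; rewrite inE yt orbT.
have [b bS] := tQ c (mem_head _ _); rewrite mul1r => cE.
exists (codom b ++ bs) => [b' y|x xbs y].
  rewrite mem_cat => /orP[/codomP[i ->] /sP[j ->]|b'bs ys]; last exact: bsD.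
  by move: j; apply/SinvP.
rewrite inE => /orP[/eqP ->|yt]; last first.
  by apply: bst => // b' z b'bs zs; apply: xbs; rewrite // mem_cat b'bs orbT.
rewrite cE mulr_sumr; apply: base_ring_sum => i _.
by apply: xbs => //; rewrite mem_cat codom_f.
Qed.

(** * The embedding of K[X] into the fraction field of D[X] *)

Section FractionPolynomials.
Variable D : idomainType.
Local Notation K := {fraction D}.
Local Notation L := {fraction {poly D}}.
Local Notation tofracK := (@FracField.tofrac D).
Local Notation tofracL := (@FracField.tofrac {poly D}).

(** A chosen numerator and denominator give the embedding of [K] into [L] by an explicit formula;
    [frac_const_div] shows that the choice does not matter. *)
Definition frac_num (x : K) : D := (s2val (cid2 (fraction_divP x))).1.
Definition frac_den (x : K) : D := (s2val (cid2 (fraction_divP x))).2.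

Lemma frac_denN0 x : frac_den x != 0.
Proof. exact: s2valP (cid2 (fraction_divP x)). Qed.

Lemma frac_numdenE x : x = tofracK (frac_num x) / tofracK (frac_den x).
Proof. exact: s2valP' (cid2 (fraction_divP x)). Qed.

Definition frac_const (x : K) : L :=
  tofracL (frac_num x)%:P / tofracL (frac_den x)%:P.

Lemma frac_const_div (a b : D) :
  b != 0 -> frac_const (tofracK a / tofracK b) = tofracL a%:P / tofracL b%:P.
Proof.
move=> b0; set x := _ / _; have d0 := frac_denN0 x.
apply/eqP; rewrite eqr_div ?tofrac_eq0 ?polyC_eq0 // -!tofracM -!polyCM tofrac_eq.
rewrite (inj_eq polyC_inj) -tofrac_eq !tofracM.
by rewrite -eqr_div ?tofrac_eq0 // -frac_numdenE.
Qed.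

Lemma frac_const_tofrac a : frac_const (tofracK a) = tofracL a%:P.
Proof.
have := frac_const_div a (oner_neq0 D).
by rewrite polyC1 !tofrac1 !divr1.
Qed.

Lemma frac_const_is_zmod_morphism : zmod_morphism frac_const.
Proof.
move=> x y; rewrite [x in LHS]frac_numdenE [y in LHS]frac_numdenE.
have [dx dy] := (frac_denN0 x, frac_denN0 y).
rewrite -mulNr addf_div ?tofrac_eq0 // mulNr -!tofracM -tofracB.
rewrite frac_const_div ?mulf_neq0 // /frac_const -[in RHS]mulNr.
rewrite addf_div ?tofrac_eq0 ?polyC_eq0 // mulNr -!tofracM -tofracB.
by rewrite polyCB !polyCM.
Qed.

Lemma frac_const_is_monoid_morphism : monoid_morphism frac_const.
Proof.
split; first by rewrite -tofrac1 frac_const_tofrac polyC1 tofrac1.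
move=> x y; rewrite [x in LHS]frac_numdenE [y in LHS]frac_numdenE.
have [dx dy] := (frac_denN0 x, frac_denN0 y).
rewrite mulf_div -!tofracM frac_const_div ?mulf_neq0 // /frac_const.
by rewrite mulf_div -!tofracM !polyCM.
Qed.

HB.instance Definition _ :=
  GRing.isZmodMorphism.Build K L frac_const frac_const_is_zmod_morphism.
HB.instance Definition _ :=
  GRing.isMonoidMorphism.Build K L frac_const frac_const_is_monoid_morphism.

Definition frac_poly : {poly K} -> L :=
  horner_eval (tofracL 'X) \o map_poly frac_const.

HB.instance Definition _ := GRing.RMorphism.on frac_poly.

Lemma frac_polyC c : frac_poly c%:P = frac_const c.
Proof. by rewrite /frac_poly /= map_polyC /horner_eval hornerC. Qed.

Lemma frac_polyX : frac_poly 'X = tofracL 'X.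
Proof. by rewrite /frac_poly /= map_polyX /horner_eval hornerX. Qed.

Lemma frac_polyZ c u : frac_poly (c *: u) = frac_const c * frac_poly u.
Proof. by rewrite -mul_polyC rmorphM /= frac_polyC. Qed.

Lemma frac_poly_map p : frac_poly (map_poly tofracK p) = tofracL p.
Proof.
elim/poly_ind: p => [|p c IHp]; first by rewrite !rmorph0.
rewrite rmorphD rmorphM /= map_polyX map_polyC rmorphD rmorphM /=.
by rewrite IHp frac_polyC frac_polyX frac_const_tofrac tofracD tofracM.
Qed.

Lemma map_tofracP (u : {poly K}) :
  (forall k, base_ring u`_k) -> exists p : {poly D}, u = map_poly tofracK p.
Proof.
move=> uD; have /choice[c cP] : forall k, exists c : D, tofracK c = u`_k.
  by move=> k; have [c _ <-] := uD k; exists c.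
exists (\poly_(k < size u) c k); apply/polyP=> k.
rewrite coef_map coef_poly; case: ltnP => [_|ku] /=; first by rewrite cP.
by rewrite tofrac0 nth_default.
Qed.

Lemma poly_common_denominator (u : {poly K}) :
  exists2 d : D, d != 0 & exists p : {poly D}, tofracK d *: u = map_poly tofracK p.
Proof.
have [d d0 dP] := common_denominator u; exists d => //; apply: map_tofracP => k.
rewrite coefZ; have [ku|ku] := ltnP k (size u); first by apply: dP; exact: mem_nth.
by rewrite nth_default // mulr0; exact: base_ring0.
Qed.

(** Clearing denominators reduces this to the injectivity of D[X] into its quotient field. *)
Lemma frac_poly_inj : injective frac_poly.
Proof.
apply: raddf_inj => u u0; have [d d0 [p pE]] := poly_common_denominator u.
have := frac_poly_map p; rewrite -pE frac_polyZ u0 mulr0 => /esym/eqP.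
rewrite tofrac_eq0 => /eqP p0; move: pE; rewrite p0 rmorph0 => /eqP.
by rewrite scaler_eq0 tofrac_eq0 (negPf d0) /= => /eqP.
Qed.

Lemma base_ring_frac_poly u : base_ring (frac_poly u) <-> forall k, base_ring u`_k.
Proof.
split=> [[p _]|/map_tofracP[p ->]]; last by rewrite frac_poly_map; exists p.
rewrite -frac_poly_map => /frac_poly_inj <- k; rewrite coef_map.
exact: base_ring_tofrac.
Qed.

Lemma base_ring_frac_const c : base_ring (frac_const c) <-> base_ring c.
Proof.
rewrite -frac_polyC base_ring_frac_poly; split=> [/(_ 0)|cD k]; rewrite coefC //.
by case: ifP => // _; exact: base_ring0.
Qed.

(** This turns elements of the inverse of an ideal into polynomials over [K] as soon as the ideal
    contains a nonzero constant. *)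
Lemma frac_polyP (z : L) (c : K) :
  c != 0 -> base_ring (z * frac_const c) -> exists u, z = frac_poly u.
Proof.
move=> c0 [p _ pE]; exists (c^-1 *: map_poly tofracK p).
by rewrite frac_polyZ frac_poly_map pE mulrC -mulrA fmorphV mulfV ?mulr1 ?fmorph_eq0.
Qed.

End FractionPolynomials.

(** * Integral closedness of D and D[X] *)

Lemma integrally_closed_of_poly (D : idomainType) :
  integrally_closed {poly D} -> integrally_closed D.
Proof.
move=> Xint x [p pm px]; apply/base_ring_frac_const; apply: Xint.
exists (map_poly polyC p); first exact: monic_map.
have -> : map_poly (@FracField.tofrac {poly D}) (map_poly polyC p) =
          map_poly (@frac_const D) (map_poly (@FracField.tofrac D) p).
  by apply/polyP => i; rewrite !coef_map /= frac_const_tofrac.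
exact: rmorph_root.
Qed.

(** Rational root argument over the principal ideal domain K[X]: in lowest terms [a / b], the
    denominator divides a power of [a], so it is constant. *)
Lemma integral_frac_poly (D : idomainType) (z : {fraction {poly D}}) :
  integralOver (@FracField.tofrac {poly D}) z -> exists u, z = frac_poly u.
Proof.
move=> [P Pm /eqP Pz]; have [[p q] /= q0 zE] := fraction_divP z.
pose f := map_poly (@FracField.tofrac D).
have fq0 : f q != 0 by rewrite map_poly_eq0_id0 ?tofrac_eq0 ?lead_coef_eq0.
pose g := gcdp (f p) (f q); pose a := f p %/ g; pose b := f q %/ g.
have aE : a * g = f p by rewrite divpK ?dvdp_gcdl.
have bE : b * g = f q by rewrite divpK ?dvdp_gcdr.
have ab : coprimep a b by apply: coprimep_div_gcd; rewrite fq0 orbT.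
have g0 : g != 0 by apply: contraNneq fq0; rewrite -bE => ->; rewrite mulr0.
have b0 : b != 0 by apply: contraNneq fq0; rewrite -bE => ->; rewrite mul0r.
have phi0 u : u != 0 -> frac_poly u != 0 :> {fraction {poly D}}.
  by move=> u0; rewrite -(rmorph0 (@frac_poly D)) (inj_eq (@frac_poly_inj D)).
have {}zE : z = frac_poly a / frac_poly b.
  rewrite zE -!frac_poly_map -[map_poly _ p]aE -[map_poly _ q]bE !rmorphM /=.
  by rewrite -mulf_div divff ?mulr1 ?phi0.
pose n := (size P).-1.
have sP : size P = n.+1 by rewrite prednK // size_poly_gt0 monic_neq0.
have Psum : \sum_(i < n.+1) f P`_i * a ^+ i * b ^+ (n - i) = 0.
  apply: (@frac_poly_inj D); rewrite rmorph0 rmorph_sum /=.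
  transitivity (frac_poly b ^+ n * (map_poly (@FracField.tofrac {poly D}) P).[z]).
    rewrite (@horner_coef_wide _ n.+1) ?size_map_poly_id0 ?sP //; last first.
      by rewrite tofrac_eq0 lead_coef_eq0 monic_neq0.
    rewrite mulr_sumr; apply: eq_bigr => i _; rewrite coef_map /=.
    rewrite !rmorphM !rmorphXn /= frac_poly_map zE expr_div_n.
    have -> : frac_poly b ^+ n = frac_poly b ^+ (n - i) * frac_poly b ^+ i.
      by rewrite -exprD subnK // -ltnS.
    rewrite -mulrA [RHS]mulrC -!mulrA; congr (_ * (_ * _)).
    by rewrite mulrCA mulVf ?mulr1 // expf_neq0 ?phi0.
  by rewrite Pz mulr0.
have ban : b %| a ^+ n.
  move: Psum; rewrite big_ord_recr /= subnn expr0 mulr1 => /eqP.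
  rewrite addrC addr_eq0 => /eqP.
  have -> : P`_n = 1 by rewrite -(monicP Pm) lead_coefE.
  rewrite /f rmorph1 mul1r => ->; rewrite dvdpNr.
  apply: (big_ind (fun u => b %| u)) => [|u v|i _]; [exact: dvdp0 | exact: dvdp_add |].
  by rewrite -[n in (n - i)%N](subnKC (ltn_ord i)) addSnnS addKn exprS mulrCA dvdp_mulr.
have : size b == 1%N.
  rewrite -coprimepp; apply: coprimep_dvdr ban _.
  by apply: coprimep_expl.
move=> /size_poly1P[c c0 bC]; exists (c^-1 *: a).
by rewrite frac_polyZ zE bC frac_polyC fmorphV mulrC.
Qed.

(* Substituting a high power of the variable for T in P(T) = (T - u) R(T) makes
   all three polynomials in X monic. *)
Lemma integrally_closed_poly (D : idomainType) :
  integrally_closed D -> integrally_closed {poly D}.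
Proof.
move=> Dint z zint; have [u zE] := integral_frac_poly zint; rewrite {}zE in zint *.
have [P Pm Pu] := zint.
pose f := map_poly (@FracField.tofrac D).
have : root (map_poly f P) u.
  rewrite /root; apply/eqP/(@frac_poly_inj D); rewrite rmorph0 -horner_map.
  rewrite -map_poly_comp (_ : map_poly _ P = map_poly (@FracField.tofrac {poly D}) P).
    exact/eqP.
  by apply/polyP => i; rewrite !coef_map /= frac_poly_map.
case/factor_theorem => R PR.
(* With [m] above all these sizes, [X^m] dominates [u], and the top term of [P] dominates the others
   after the substitution. *)
pose m := (size u + \max_(i < size P) size (P`_i)%R).+1.
have mu : (size u < m)%N by rewrite ltnS leq_addr.
have mP i : (size (P`_i)%R < m)%N.
  have [iP|iP] := ltnP i (size P); last by rewrite nth_default ?size_poly0.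
  rewrite ltnS; apply: leq_trans (leq_addl _ _).
  exact: (@leq_bigmax 'I_(size P) (fun i => size P`_i) (Ordinal iP)).
have PXm : P.['X^m] \is monic.
  pose n := (size P).-1.
  have sP : size P = n.+1 by rewrite prednK // size_poly_gt0 monic_neq0.
  rewrite horner_coef sP big_ord_recr /=.
  have -> : P`_n = 1 by rewrite -(monicP Pm) lead_coefE.
  rewrite mul1r addrC -exprM monicE lead_coefDl ?lead_coefXn //.
  rewrite size_polyXn ltnS; apply: leq_trans (size_sum _ _ _) _.
  apply/bigmax_leqP => i _; apply: leq_trans (size_polyMleq _ _) _.
  rewrite -exprM size_polyXn addnS /=.
  apply: (@leq_trans (m * i.+1)); last by rewrite leq_mul2l ltn_ord orbT.
  by rewrite mulnS leq_add2r ltnW.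
have PRm : f P.['X^m] = R.['X^m] * ('X^m - u).
  by rewrite /f -horner_map /= map_polyXn -/f PR hornerM hornerD hornerN hornerX hornerC.
have Xum : 'X^m - u \is monic.
  by rewrite monicE lead_coefDl ?lead_coefXn // size_polyN size_polyXn ltnS ltnW.
have RXm : R.['X^m] \is monic by rewrite -(monicMr _ Xum) -PRm monic_map.
apply/base_ring_frac_poly => k.
have [km|mk] := ltnP k m; last first.
  by rewrite nth_default ?(leq_trans (ltnW mu)) //; exact: base_ring0.
have RXD j : base_ring (R.['X^m] * ('X^m - u))`_j.
  by rewrite -PRm coef_map; exact: base_ring_tofrac.
(* For [k < m] the coefficient of [X^m - u] is [- u_k]; it is paired with the leading coefficient 1
   of the cofactor. *)
have := integrally_closed_coef_mul Dint RXD (size R.['X^m]).-1 k.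
rewrite -lead_coefE (monicP RXm) mul1r coefB coefXn (ltn_eqF km) => uk.
by rewrite -[u`_k](subKr 0); apply: base_ringB uk; exact: base_ring0.
Qed.

(** * From D[X] down to D *)

Lemma w_divisorial_of_poly (D : idomainType) :
  w_divisorial {poly D} -> w_divisorial D.
Proof.
move=> /w_divisorialP Xw; apply/w_divisorialP => I zI x xv.
have [mI ID [a Ia a0]] := (nonzero_idealP _).1 zI; have [I0 IA IM] := mI.
pose IX : set {fraction {poly D}} :=
  [set z | exists2 u, z = frac_poly u & forall k, I u`_k].
have ICX c : I c -> IX (frac_const c).
  move=> Ic; exists c%:P; first by rewrite frac_polyC.
  by move=> k; rewrite coefC; case: ifP.
have mIX : submodule IX.
  split.
  - by exists 0 => [|k]; rewrite ?rmorph0 ?coef0.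
  - move=> _ _ [u -> Iu] [v -> Iv]; exists (u + v) => [|k]; first by rewrite rmorphD.
    by rewrite coefD; exact: IA.
  - move=> _ _ [p _ <-] [v -> Iv]; exists (map_poly (@FracField.tofrac D) p * v).
      by rewrite rmorphM /= frac_poly_map.
    move=> k; rewrite coefM; apply: submodule_sum => // i _; apply: IM => //.
    by rewrite coef_map; exact: base_ring_tofrac.
have zIX : nonzero_ideal IX.
  apply/nonzero_idealP; split=> //.
    by move=> _ [u -> Iu]; apply/base_ring_frac_poly => k; exact: ID.
  by exists (frac_const a); [exact: ICX | rewrite fmorph_eq0].
have xXv : v_closure IX (frac_const x).
  (* An element of the inverse of [IX] is a polynomial [v] over [K], because [I] contains the
     nonzero constant [a]; the coefficients of [v] then lie in I^{-1}. *)
  move=> y yI; have [v yE] := frac_polyP a0 (yI _ (ICX _ Ia)).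
  rewrite yE -frac_polyZ; apply/base_ring_frac_poly => k; rewrite coefZ.
  apply: xv => b Ib; have := yI _ (ICX _ Ib).
  rewrite yE mulrC -frac_polyZ => /base_ring_frac_poly/(_ k).
  by rewrite coefZ mulrC.
have /(w_closureP _ mIX)[T [TD [t0 tT t0N0] TI] xT] := Xw _ zIX _ xXv.
(* [g] gives the polynomial over [K] behind each element of D[X]; the default value 0 is taken only
   outside D[X], hence never on [T]. *)
have /choice[g gP] : forall y : {fraction {poly D}}, exists u : {poly {fraction D}},
    base_ring y -> y = frac_poly u /\ forall k, base_ring u`_k.
  move=> y; have [[p _ <-]|ny] := pselect (base_ring y); last by exists 0.
  exists (map_poly (@FracField.tofrac D) p) => _; rewrite frac_poly_map.
  by split=> // k; rewrite coef_map; exact: base_ring_tofrac.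
pose s := [seq c | y <- T, c <- g y : seq _].
have sP c : c \in s -> exists2 y, y \in T & exists k, c = (g y)`_k.
  move=> /allpairsPdep[y [d [yT dg ->]]]; exists y => //.
  by have /(nthP 0)[k _ <-] := dg; exists k.
have gs y k : y \in T -> (g y)`_k = 0 \/ (g y)`_k \in s.
  move=> yT; have [kg|kg] := ltnP k (size (g y)); last by left; rewrite nth_default.
  by right; apply/allpairsPdep; exists y, (g y)`_k; rewrite yT mem_nth.
apply/w_closureP => //; exists s.
  split.
  - by move=> c /sP[y yT [k ->]]; have [_] := gP _ (TD _ yT).
  - have [t0E _] := gP _ (TD _ tT); exists (lead_coef (g t0)).
      have [g0|//] := gs _ (size (g t0)).-1 tT.
      move: t0N0; rewrite t0E; move/eqP: g0.
      by rewrite -lead_coefE lead_coef_eq0 => /eqP ->; rewrite rmorph0 eqxx.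
    rewrite lead_coef_eq0; apply: contraNneq t0N0 => g0.
    by rewrite t0E g0 rmorph0.
  (* If [z] multiplies all coefficients into D, its constant image multiplies [T] into D[X], hence
     lies in D[X] as [T] is gv. *)
  - move=> z zs; apply/base_ring_frac_const; apply: TI => y yT.
    have [-> _] := gP _ (TD _ yT); rewrite -frac_polyZ.
    apply/base_ring_frac_poly => k; rewrite coefZ.
    by have [->|/zs//] := gs _ k yT; rewrite mulr0; exact: base_ring0.
move=> _ /sP[y yT [k ->]]; have [u] := xT _ yT.
have [yE _] := gP _ (TD _ yT); rewrite [y in LHS]yE -frac_polyZ => /frac_poly_inj uE.
by move=> /(_ k); rewrite -uE coefZ.
Qed.

(** * From D up to D[X] *)

Lemma gv_frac_const (D : idomainType) (s : seq {fraction D}) :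
  gv s -> gv (map (@frac_const D) s).
Proof.
move=> [sD [a sa a0] sI]; split.
- by move=> _ /mapP[c cs ->]; apply/base_ring_frac_const; exact: sD.
- by exists (frac_const a); [exact: map_f | rewrite fmorph_eq0].
(* A multiplier is a polynomial since the list contains the nonzero constant [a]; its coefficients
   are then tested one by one against [s]. *)
- move=> z zs; have [v vE] := frac_polyP a0 (zs _ (map_f _ sa)).
  rewrite vE; apply/base_ring_frac_poly => k; apply: sI => c cs.
  have := zs _ (map_f (@frac_const D) cs).
  by rewrite vE mulrC -frac_polyZ => /base_ring_frac_poly/(_ k); rewrite coefZ mulrC.
Qed.

(** The constant [d] forces a multiplier to be a polynomial [v] over [K]. Then each [v * (b *: u)]
    is in D[X], so Dedekind-Mertens puts all [v_k * (b * u_j)] in D, and the last hypothesis on [bs]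
    applies. *)
Lemma gv_frac_poly (D : idomainType) (d : {fraction D}) (u : {poly {fraction D}})
    (bs : seq {fraction D}) :
  integrally_closed D -> d != 0 -> base_ring d ->
  (forall b a, b \in bs -> a \in (u : seq _) -> base_ring (b * a)) ->
  (forall x, (forall b a, b \in bs -> a \in (u : seq _) -> base_ring (x * (b * a))) ->
    base_ring x) ->
  gv (frac_const d :: [seq frac_poly (b *: u) | b <- bs]).
Proof.
move=> Dint d0 dD bsD bsI; split.
- move=> y; rewrite inE => /orP[/eqP ->|/mapP[b bbs ->]].
    exact/base_ring_frac_const.
  apply/base_ring_frac_poly => k; rewrite coefZ.
  have [ku|ku] := ltnP k (size u); first by apply: bsD; rewrite ?mem_nth.
  by rewrite nth_default // mulr0; exact: base_ring0.
- by exists (frac_const d); rewrite ?mem_head ?fmorph_eq0.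
- move=> z zs; have [v vE] := frac_polyP d0 (zs _ (mem_head _ _)).
  rewrite vE; apply/base_ring_frac_poly => k; apply: bsI => b _ bbs /(nthP 0)[j _ <-].
  rewrite -coefZ; apply: integrally_closed_coef_mul => //.
  apply/base_ring_frac_poly; rewrite rmorphM /= -vE; apply: zs.
  by rewrite inE; apply/orP; right; apply/mapP; exists b.
Qed.

Lemma w_divisorial_poly (D : idomainType) :
  integrally_closed D -> w_divisorial D -> w_divisorial {poly D}.
Proof.
move=> Dint Dw W [zW Wcl].
have [mW WD [w0 Ww0 w0N0]] := (nonzero_idealP _).1 zW; have [W0 WA WM] := mW.
have Ww z s : gv s -> (forall y, y \in s -> W (z * y)) -> W z.
  by move=> sgv zs; rewrite Wcl; apply/w_closureP => //; exists s.
have [f [f0 Wf fmin]] : exists f : {poly D}, [/\ f != 0, W (tofrac f) &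
    forall g, W (tofrac g) -> (size g < size f)%N -> g = 0].
  have [p _ pE] := WD _ Ww0; rewrite -pE in Ww0 w0N0.
  rewrite tofrac_eq0 in w0N0; move: {-1}(size p) (leqnn (size p)) => n.
  elim: n p {pE} w0N0 Ww0 => [|n IHn] p p0 Wp sp.
    by move: p0; rewrite -size_poly_leq0 sp.
  have [[g [Wg gp g0]]|nog] :=
    pselect (exists g, [/\ W (tofrac g), (size g < size p)%N & g != 0]).
    by apply: (IHn g) => //; rewrite -ltnS; exact: leq_trans sp.
  exists p; split=> // g Wg gp; apply: contrapT => /eqP g0.
  by apply: nog; exists g.
pose F : {fraction {poly D}} := tofrac f.
have F0 : F != 0 by rewrite tofrac_eq0.
have Wdiv h : W h -> exists u, h = F * frac_poly u.
  move=> Wh; have [g _ gE] := WD _ Wh; rewrite -{}gE in Wh *.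
  (* Pseudo-division: [c * g] is a multiple of [f] plus a remainder in [W] of smaller size, which
     vanishes by minimality, so [g] is [f] times a polynomial over [K]. *)
  have := Pdiv.Idomain.divp_eq g f; set c := _ ^+ _ => gE.
  have c0 : c != 0 by rewrite expf_neq0 ?lead_coef_eq0.
  have r0 : g %% f = 0.
    apply: fmin; last by rewrite ltn_modp.
    have -> : g %% f = c%:P * g + (- (g %/ f)) * f.
      by rewrite mul_polyC gE mulNr addrAC subrr add0r.
    by rewrite tofracD !tofracM; apply: WA; apply: WM => //; exact: base_ring_tofrac.
  exists ((tofrac c)^-1 *: map_poly (@FracField.tofrac D) (g %/ f)).
  rewrite frac_polyZ frac_poly_map fmorphV /= frac_const_tofrac.
  apply: (mulfI (x := tofrac c%:P)); first by rewrite tofrac_eq0 polyC_eq0.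
  rewrite [RHS]mulrCA mulVKf ?tofrac_eq0 ?polyC_eq0 //.
  by rewrite -tofracM mul_polyC gE r0 addr0 tofracM mulrC.
pose I : set {fraction D} := [set x | W (frac_const x * F)].
have mI : submodule I.
  split; rewrite /I /=.
  - by rewrite rmorph0 mul0r.
  - by move=> x y Ix Iy; rewrite rmorphD mulrDl; exact: WA.
  - move=> x y xD Iy; rewrite rmorphM -mulrA; apply: WM => //.
    exact/base_ring_frac_const.
have [I0 IA IM] := mI.
have I1 : I 1 by rewrite /I /= rmorph1 mul1r.
have WI u : W (F * frac_poly u) -> forall k, I u`_k.
  move=> Wu k; have [ku|ku] := ltnP k (size u); last by rewrite nth_default.
  have u0 : (0 < size u)%N by exact: leq_ltn_trans ku.
  have [|bs bsD bsI] := @finite_w_inverse _ u Dint Dw.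
    exists (lead_coef u); last by rewrite lead_coef_eq0 -size_poly_gt0.
    by rewrite lead_coefE mem_nth ?prednK.
  have [d d0 du] := common_denominator u.
  have d0' : tofrac d != 0 :> {fraction D} by rewrite tofrac_eq0.
  have uk : u`_k \in (u : seq _) by exact: mem_nth.
  (* [u_k F] times [d] is [d u_k] times [F], and times [b u] it is [b u_k] times [F u]; both are in
     [W] as [d u_k] and [b u_k] are in D. *)
  apply: Ww (gv_frac_poly Dint d0' (base_ring_tofrac d) bsD bsI) _ => y.
  rewrite inE => /orP[/eqP ->|/mapP[b bbs ->]].
    rewrite mulrAC -rmorphM /= mulrC [_ * tofrac d]mulrC mulrC.
    by apply: WM => //; apply/base_ring_frac_const; exact: du.
  rewrite frac_polyZ mulrACA -rmorphM; apply: WM => //.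
    by apply/base_ring_frac_const; rewrite mulrC; exact: bsD.
have Wpoly (v : {poly {fraction D}}) : (forall k, I v`_k) -> W (F * frac_poly v).
  move=> Iv; rewrite -[v]coefK poly_def rmorph_sum /= mulr_sumr.
  apply: submodule_sum => // k _; rewrite frac_polyZ mulrA mulrC /=.
  apply: WM; last by rewrite mulrC; exact: Iv.
  rewrite rmorphXn /= frac_polyX -tofracXn; exact: base_ring_tofrac.
(* Each [x] in [I] has [x f] in D[X], so the leading coefficient of [f] is a common denominator that
   turns [I] into an integral ideal. *)
pose c : {fraction D} := tofrac (lead_coef f).
have c0 : c != 0 by rewrite tofrac_eq0 lead_coef_eq0.
have cI x : I x -> base_ring (c * x).
  move=> /WD; rewrite /F -frac_poly_map -frac_polyZ.
  move=> /base_ring_frac_poly/(_ (size f).-1).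
  by rewrite coefZ coef_map mulrC.
pose cI' : set {fraction D} := [set y | exists2 x, I x & y = c * x].
have cIid : nonzero_ideal cI'.
  apply/nonzero_idealP; split.
  - split.
    + by exists 0 => //; rewrite mulr0.
    + by move=> _ _ [x Ix ->] [y Iy ->]; exists (x + y); rewrite ?mulrDr //; exact: IA.
    + by move=> x _ xD [y Iy ->]; exists (x * y); [exact: IM | rewrite mulrCA].
  - by move=> _ [x Ix ->]; exact: cI.
  - by exists c => //; exists 1; rewrite ?mulr1.
have [mcI _ _] := (nonzero_idealP _).1 cIid.
split=> //; apply/seteqP; split; first exact: sub_v_closure.
move=> h hv.
have Winv y : ideal_inv I y -> ideal_inv W (frac_const y / F).
  move=> yI w Wwt; have [u wE] := Wdiv _ Wwt; rewrite wE in Wwt *.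
  rewrite mulrA divfK // -frac_polyZ; apply/base_ring_frac_poly => k.
  by rewrite coefZ; apply: yI; exact: WI.
(* [c] lies in I^{-1} by [cI], so [h * c / F] is in D[X] and [h / F] is a polynomial over [K]. *)
have [|v vE] := @frac_polyP D (h / F) c c0.
  by rewrite mulrAC -mulrA; apply: hv; apply: Winv => x; exact: cI.
have {}vE : h = F * frac_poly v by rewrite -vE mulrC divfK.
rewrite vE; apply: Wpoly => k.
have vkc : v_closure cI' (c * v`_k).
  move=> z zcI; rewrite mulrAC [c * z]mulrC.
  have zc : ideal_inv I (z * c).
    by move=> x Ix; rewrite -mulrA; apply: zcI; exists x.
  have : base_ring (h * (frac_const (z * c) / F)) := hv _ (Winv _ zc).
  rewrite vE [_ * (_ / _)]mulrC mulrA divfK // -frac_polyZ => /base_ring_frac_poly/(_ k).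
  by rewrite coefZ.
have /(w_closureP _ mcI)[s sgv vs] := (w_divisorialP D).1 Dw _ cIid _ vkc.
(* Cancelling [c] shows that [s] multiplies [v_k] into [I]; read as constants, [s] multiplies
   [v_k F] into [W]. *)
apply: Ww (gv_frac_const sgv) _ => _ /mapP[y ys ->].
have [x Ix] := vs _ ys; rewrite -mulrA => /(mulfI c0) vxE.
by rewrite mulrAC -rmorphM vxE.
Qed.

Theorem corollary3p5 (D : idomainType) :
  (integrally_closed D /\ w_divisorial D) <->
  (integrally_closed {poly D} /\ w_divisorial {poly D}).
Proof.
split=> [[Dint Dw]|[Xint Xw]].
  by split; [exact: integrally_closed_poly | exact: w_divisorial_poly].
by split; [exact: integrally_closed_of_poly | exact: w_divisorial_of_poly].
Qed.
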